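(* Let $\mathcal{M}\subset\mathbb{R}^d$ be a watertight, not necessarily bounded, piecewise linear hypersurface. Then there exists a multilayer perceptron with ReLU activations $F:\mathbb{R}^d\to\mathbb{R}$ whose neural level set is exactly $\mathcal{M}$, i.e. $\mathcal{M}=\{x\in\mathbb{R}^d \mid F(x)=0\}$.
   Context: A piecewise linear hypersurface in $\mathbb{R}^d$ is a $(d-1)$-dimensional manifold in $\mathbb{R}^d$ built out of a finite number of linear pieces (each piece lies in an affine hyperplane; pieces are not necessarily bounded). It is called watertight if it is the boundary of a $d$-dimensional polytope $P\subset\mathbb{R}^d$, where ''polytope'' is understood as a region bounded by finitely many flat faces lying in hyperplanes, and is not required to be convex or bounded. A multilayer perceptron (MLP) with ReLU activations $F:\mathbb{R}^d\to\mathbb{R}$ is a function of the form $F=A_L\circ\sigma\circ A_{L-1}\circ\sigma\circ\cdots\circ\sigma\circ A_1$, where $A_1,\dots,A_L$ are affine maps between finite-dimensional real vector spaces of arbitrary (compatible) dimensions, $L$ is arbitrary, and $\sigma(s)=\max(0,s)$ is applied coordinatewise. The neural level set of $F$ is its zero level set $\mathcal{S}=\{x\in\mathbb{R}^d\mid F(x)=0\}$. *)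

(* Defs.v *)
From HB Require Import structures.
From mathcomp Require Import all_boot all_order all_algebra.
From mathcomp Require Import all_classical all_reals all_analysis.

Set Implicit Arguments.
Unset Strict Implicit.
Unset Printing Implicit Defensive.

Import Order.TTheory GRing.Theory Num.Theory numFieldNormedType.Exports.
Local Open Scope classical_set_scope.
Local Open Scope ring_scope.

(* Points of R^d are row vectors 'rV[R]_d; their library topology is the one of
   the sup norm, i.e. the usual topology of R^d. *)

Definition boundary (T : topologicalType) (A : set T) : set T :=
  closure A `\` interior A.

Section PiecewiseLinear.
Variables (R : realType) (d : nat).
Implicit Types (H Q M P : set 'rV[R]_d).

Definition affine_hyperplane H : Prop :=
  exists (a : 'cV[R]_d) (c : R),
    a != 0 /\ H = [set x | (x *m a) ord0 ord0 = c].

(* Each column of [A] gives one closed half-space, so unbounded polyhedra are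
   included. *)
Definition convex_polyhedron Q : Prop :=
  exists (m : nat) (A : 'M[R]_(d, m)) (b : 'rV[R]_m),
    Q = [set x | forall j : 'I_m, (x *m A) ord0 j <= b ord0 j].

Definition polyhedral_set Q : Prop :=
  exists (n : nat) (C : 'I_n -> set 'rV[R]_d),
    (forall i, convex_polyhedron (C i)) /\ Q = \bigcup_i C i.

(* A linear piece need be neither convex nor bounded. *)
Definition linear_piece Q : Prop :=
  polyhedral_set Q /\ exists2 H, affine_hyperplane H & Q `<=` H.

Definition finite_union_of_linear_pieces M : Prop :=
  exists (n : nat) (Q : 'I_n -> set 'rV[R]_d),
    (forall i, linear_piece (Q i)) /\ M = \bigcup_i Q i.

(* [M], with the topology induced by R^d, is locally homeomorphic to open
   subsets of R^k; being Hausdorff and second countable is automatic for a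
   subspace of R^d. *)
Definition topological_manifold (k : nat) M : Prop :=
  forall x, M x ->
    exists (U : set 'rV[R]_d) (V : set 'rV[R]_k)
           (f : 'rV[R]_d -> 'rV[R]_k) (g : 'rV[R]_k -> 'rV[R]_d),
      [/\ open U /\ U x,
          open V,
          {within M `&` U, continuous f} /\ {within V, continuous g},
          (forall y, (M `&` U) y -> V (f y) /\ g (f y) = y) &
          (forall z, V z -> (M `&` U) (g z) /\ f (g z) = z)].

Definition pl_hypersurface M : Prop :=
  topological_manifold d.-1 M /\ finite_union_of_linear_pieces M.

(* A region of full dimension [d] (the closure of its nonempty interior) whose
   boundary consists of finitely many flat faces; neither convexity nor
   boundedness is required. *)
Definition polytope P : Prop :=
  [/\ P !=set0, P = closure (interior P) &
      finite_union_of_linear_pieces (boundary P)].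

Definition watertight M : Prop :=
  exists2 P, polytope P & M = boundary P.

End PiecewiseLinear.

Section MultilayerPerceptron.
Variable R : realType.

Definition relu n (x : 'rV[R]_n) : 'rV[R]_n := map_mx (Num.max 0) x.

(* Weights and biases of a perceptron from R^m to R^p: [AffineLayer W b] is the
   last map A_L, [HiddenLayer W b N] is N \o relu \o (x |-> x *m W + b). *)
Inductive mlp (p : nat) : nat -> Type :=
| AffineLayer m of 'M[R]_(m, p) & 'rV[R]_p : mlp p m
| HiddenLayer m h of 'M[R]_(m, h) & 'rV[R]_h & mlp p h : mlp p m.

Fixpoint mlp_eval p m (N : mlp p m) : 'rV[R]_m -> 'rV[R]_p :=
  match N with
  | AffineLayer _ W b => fun x => x *m W + b
  | HiddenLayer _ _ W b N' => fun x => mlp_eval N' (relu (x *m W + b))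
  end.

Definition is_relu_mlp d (F : 'rV[R]_d -> R) : Prop :=
  exists N : mlp 1 d, forall x, F x = mlp_eval N x ord0 ord0.

End MultilayerPerceptron.

Definition neural_level_set (R : realType) (d : nat) (F : 'rV[R]_d -> R)
  : set 'rV[R]_d := [set x | F x = 0].

(* Main.v *)
Require Import Defs.
From mathcomp Require Import all_boot all_order all_algebra.
From mathcomp Require Import all_classical all_reals all_analysis.

(** A hypersurface is in particular a finite union of convex polyhedra. The
    half-space [u <= 0] is the zero set of the nonnegative function
    [max 0 u]; zero sets of nonnegative functions are closed under finite
    intersections (add the functions) and finite unions (take their minimum,
    [min f g = f - max 0 (f - g)]). *)

Set Implicit Arguments.
Unset Strict Implicit.
Unset Printing Implicit Defensive.

Import Order.TTheory GRing.Theory Num.Theory.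
Local Open Scope classical_set_scope.
Local Open Scope ring_scope.

Section ReluFunctions.
Variable R : realType.

(** Vector-valued counterpart of [is_relu_mlp]: composing networks and pairing their outputs passes
    through intermediate spaces of arbitrary dimension. *)
Definition mlp_computes m p (f : 'rV[R]_m -> 'rV[R]_p) : Prop :=
  exists N : mlp R p m, mlp_eval N =1 f.

Lemma mlp_computes_affine m p (W : 'M[R]_(m, p)) (b : 'rV[R]_p) :
  mlp_computes (fun x => x *m W + b).
Proof. by exists (AffineLayer W b). Qed.

Lemma mlp_computes_linear m p (W : 'M[R]_(m, p)) :
  mlp_computes (fun x => x *m W).
Proof. by exists (AffineLayer W 0) => x /=; rewrite addr0. Qed.

Lemma mlp_computes_relu m : mlp_computes (@relu R m).
Proof.
by exists (HiddenLayer 1%:M 0 (AffineLayer 1%:M 0)) => x /=; rewrite !mulmx1 !addr0.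
Qed.

Lemma eq_mlp_computes m p (f g : 'rV[R]_m -> 'rV[R]_p) :
  f =1 g -> mlp_computes f -> mlp_computes g.
Proof. by move=> fg [N Nf]; exists N => x; rewrite Nf fg. Qed.

(** No activation separates the last affine map of the first network from the first affine map of
    the second, so these two merge into one affine map; all other layers are kept. *)
Lemma mlp_computes_comp m p q (f : 'rV[R]_m -> 'rV[R]_p)
    (g : 'rV[R]_p -> 'rV[R]_q) :
  mlp_computes f -> mlp_computes g -> mlp_computes (g \o f).
Proof.
move=> [N Nf] [N' N'g]; apply: (@eq_mlp_computes _ _ (mlp_eval N' \o mlp_eval N)).
  by move=> x /=; rewrite Nf N'g.
move=> {f g Nf N'g}; elim: N => {m} [m W b|m h W b N [K KE]]; last first.
  by exists (HiddenLayer W b K) => x /=; rewrite KE.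
case: p / N' W b => [p V c|p h V c K] W b.
  by exists (AffineLayer (W *m V) (b *m V + c)) => x /=; rewrite mulmxDl mulmxA addrA.
by exists (HiddenLayer (W *m V) (b *m V + c) K) => x /=; rewrite mulmxDl mulmxA addrA.
Qed.

Lemma relu_row_mx m n (x : 'rV[R]_m) (y : 'rV[R]_n) :
  relu (row_mx x y) = row_mx (relu x) (relu y).
Proof. exact: map_row_mx. Qed.

Lemma reluBN n (y : 'rV[R]_n) : relu y - relu (- y) = y.
Proof.
apply/rowP => j; rewrite !mxE.
by have [y0|y0] := leP 0 (y ord0 j); [rewrite (max_idPl _)|rewrite (max_idPr _)];
  rewrite ?subr0 ?sub0r ?opprK // ?oppr_le0 ?oppr_ge0 // ltW.
Qed.

(* The idle coordinates pass through each hidden layer as [relu y - relu (- y)]. *)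
Lemma mlp_computes_widen m p k (f : 'rV[R]_m -> 'rV[R]_p) :
  mlp_computes f ->
  mlp_computes (fun z : 'rV[R]_(m + k) => row_mx (f (lsubmx z)) (rsubmx z)).
Proof.
move=> [N Nf]; apply: (@eq_mlp_computes _ _
  (fun z : 'rV_(m + k) => row_mx (mlp_eval N (lsubmx z)) (rsubmx z))).
  by move=> z; rewrite Nf.
move=> {f Nf}; elim: N => {m} [m W b|m h W b N IH].
  exists (AffineLayer (block_mx W 0 0 1%:M) (row_mx b 0)) => z /=.
  rewrite -{1}[z]hsubmxK mul_row_block !mulmx0 mulmx1 addr0 add0r.
  by rewrite add_row_mx addr0.
apply: eq_mlp_computes (mlp_computes_comp _ IH) => [z|]; last first.
  (* On a pair [(x, y)] the hidden layer produces [(x *m W + b, y, - y)]; after the activation, the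
     output matrix keeps the first block and subtracts the third from the second, which restores
     [y]. *)
  exists (HiddenLayer (block_mx W 0 0 (row_mx 1%:M (- 1%:M)))
    (row_mx b 0) (AffineLayer (block_mx 1%:M 0 0 (col_mx 1%:M (- 1%:M))) 0)).
  exact: frefl.
rewrite /= addr0 -{1 2}[z]hsubmxK mul_row_block !mulmx0 addr0 add0r.
rewrite mul_mx_row mulmxN mulmx1 add_row_mx addr0 !relu_row_mx.
rewrite mul_row_block !mulmx0 mulmx1 addr0 add0r mul_row_col mulmxN !mulmx1.
by rewrite reluBN row_mxKl row_mxKr.
Qed.

(** The two networks may differ in depth, so they are run one after the other, each carrying along
    the data that the other needs: [x], [(x, x)], [(f x, x)], [(x, f x)], [(g x, f x)],
    [(f x, g x)]. *)
Lemma mlp_computes_row_mx m p q (f : 'rV[R]_m -> 'rV[R]_p)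
    (g : 'rV[R]_m -> 'rV[R]_q) :
  mlp_computes f -> mlp_computes g ->
  mlp_computes (fun x => row_mx (f x) (g x)).
Proof.
move=> /(mlp_computes_widen m) f' /(mlp_computes_widen p) g'.
have swap a b : mlp_computes (fun z : 'rV[R]_(a + b) => row_mx (rsubmx z) (lsubmx z)).
  apply: eq_mlp_computes (mlp_computes_linear (block_mx 0 1%:M 1%:M 0)) => z.
  by rewrite -{1}[z]hsubmxK mul_row_block !mulmx0 !mulmx1 addr0 add0r.
have dup := mlp_computes_linear (row_mx (1%:M : 'M[R]_m) 1%:M).
have fgP := mlp_computes_comp (mlp_computes_comp (mlp_computes_comp
  (mlp_computes_comp dup f') (swap _ _)) g') (swap _ _).
apply: eq_mlp_computes fgP => x /=.
by rewrite mul_mx_row !mulmx1 ?(row_mxKl, row_mxKr).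
Qed.

Variable d : nat.
Implicit Types F G : 'rV[R]_d -> R.

Lemma is_relu_mlpE F : is_relu_mlp F <-> mlp_computes (fun x => (F x)%:M : 'rV_1).
Proof.
split=> -[N NF]; exists N => x.
  by rewrite NF -mx11_scalar.
by rewrite NF mxE.
Qed.

Lemma is_relu_mlp_affine (a : 'cV[R]_d) (c : R) :
  is_relu_mlp (fun x => (x *m a) ord0 ord0 + c).
Proof.
by exists (AffineLayer a c%:M) => x; rewrite /= !mxE eqxx mulr1n.
Qed.

Lemma is_relu_mlp_cst (c : R) : is_relu_mlp (fun _ : 'rV[R]_d => c).
Proof.
have := is_relu_mlp_affine 0 c; congr is_relu_mlp; apply/funext => x.
by rewrite mulmx0 mxE add0r.
Qed.

Lemma is_relu_mlp_max0 F : is_relu_mlp F -> is_relu_mlp (fun x => Num.max 0 (F x)).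
Proof.
move=> /is_relu_mlpE /mlp_computes_comp /(_ (mlp_computes_relu _)) FP.
apply/is_relu_mlpE; apply: eq_mlp_computes FP => x.
by apply/rowP => j; rewrite /= !mxE !ord1.
Qed.

(** The coefficient [k] serves both sums ([k = 1]) and the differences in the formula for the
    minimum ([k = -1]). *)
Lemma is_relu_mlp_add_scale F G (k : R) : is_relu_mlp F -> is_relu_mlp G ->
  is_relu_mlp (fun x => F x + k * G x).
Proof.
move=> /is_relu_mlpE FP /is_relu_mlpE GP; apply/is_relu_mlpE.
apply: eq_mlp_computes (mlp_computes_comp (mlp_computes_row_mx FP GP)
  (mlp_computes_linear (col_mx 1%:M k%:M))) => x /=.
rewrite mul_row_col mulmx1 -scalar_mxM mulrC.
by rewrite -[RHS]/(scalar_mx _) raddfD.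
Qed.

Lemma is_relu_mlp_add F G :
  is_relu_mlp F -> is_relu_mlp G -> is_relu_mlp (fun x => F x + G x).
Proof.
move=> FP GP; have := is_relu_mlp_add_scale 1 FP GP.
by under eq_fun do rewrite mul1r.
Qed.

Lemma is_relu_mlp_min F G :
  is_relu_mlp F -> is_relu_mlp G -> is_relu_mlp (fun x => Num.min (F x) (G x)).
Proof.
move=> FP GP.
have := is_relu_mlp_add_scale (-1) FP
  (is_relu_mlp_max0 (is_relu_mlp_add_scale (-1) FP GP)).
congr is_relu_mlp; apply/funext => x; rewrite !mulN1r.
have [FG|GF] := leP (F x) (G x).
  by rewrite (max_idPl _) ?subr_le0 // subr0.
by rewrite (max_idPr _) ?subr_ge0 1?ltW // opprB addrC subrK.
Qed.

(** Nonnegativity is carried along because without it two terms of a sum could cancel, and a minimum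
    could be negative at a zero of one of its arguments. *)
Definition nonneg_neural_set (A : set 'rV[R]_d) : Prop :=
  exists F, [/\ is_relu_mlp F, forall x, 0 <= F x & A = neural_level_set F].

Lemma nonneg_neural_set0 : nonneg_neural_set set0.
Proof.
exists (fun=> 1); split=> //; first exact: is_relu_mlp_cst.
by apply/seteqP; split=> x //= /eqP; rewrite oner_eq0.
Qed.

Lemma nonneg_neural_setT : nonneg_neural_set setT.
Proof.
exists (fun=> 0); split=> //; first exact: is_relu_mlp_cst.
by apply/seteqP; split.
Qed.

Lemma nonneg_neural_setU A B :
  nonneg_neural_set A -> nonneg_neural_set B -> nonneg_neural_set (A `|` B).
Proof.
move=> [F [FP F0 ->]] [G [GP G0 ->]].
exists (fun x => Num.min (F x) (G x)); split; first exact: is_relu_mlp_min.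
  by move=> x; rewrite le_min F0 G0.
apply/seteqP; split=> x; rewrite /neural_level_set /=.
  by case=> ->; [rewrite (min_idPl _)|rewrite (min_idPr _)].
by case: leP => _ ?; [left|right].
Qed.

Lemma nonneg_neural_setI A B :
  nonneg_neural_set A -> nonneg_neural_set B -> nonneg_neural_set (A `&` B).
Proof.
move=> [F [FP F0 ->]] [G [GP G0 ->]].
exists (fun x => F x + G x); split; first exact: is_relu_mlp_add.
  by move=> x; rewrite addr_ge0.
apply/seteqP; split=> x; rewrite /neural_level_set /=.
  by case=> -> ->; rewrite addr0.
by move=> /eqP; rewrite paddr_eq0 // => /andP[/eqP ? /eqP ?].
Qed.

Lemma nonneg_neural_set_halfspace (a : 'cV[R]_d) (c : R) :
  nonneg_neural_set [set x | (x *m a) ord0 ord0 <= c].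
Proof.
exists (fun x => Num.max 0 ((x *m a) ord0 ord0 + - c)); split.
- exact/is_relu_mlp_max0/is_relu_mlp_affine.
- by move=> x; rewrite le_max lexx.
by apply/seteqP; split=> x; rewrite /neural_level_set /= -subr_le0 => /max_idPl.
Qed.

Lemma nonneg_neural_set_bigcup n (C : 'I_n -> set 'rV[R]_d) :
  (forall i, nonneg_neural_set (C i)) -> nonneg_neural_set (\bigcup_i C i).
Proof.
(* Indexing by a sequence turns the union into an iterated binary one, to which [big_ind]
   applies. *)
move=> CP; have -> : [set: 'I_n] = [set` enum 'I_n].
  by apply/seteqP; split=> i //= _; rewrite mem_enum.
rewrite bigcup_seq; elim/big_ind: _ => //.
- exact: nonneg_neural_set0.
- exact: nonneg_neural_setU.
Qed.

Lemma nonneg_neural_set_bigcap n (C : 'I_n -> set 'rV[R]_d) :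
  (forall i, nonneg_neural_set (C i)) -> nonneg_neural_set (\bigcap_i C i).
Proof.
move=> CP; have -> : [set: 'I_n] = [set` enum 'I_n].
  by apply/seteqP; split=> i //= _; rewrite mem_enum.
rewrite bigcap_seq; elim/big_ind: _ => //.
- exact: nonneg_neural_setT.
- exact: nonneg_neural_setI.
Qed.

Lemma nonneg_neural_set_convex_polyhedron Q :
  convex_polyhedron Q -> nonneg_neural_set Q.
Proof.
move=> [m [A [b ->]]].
(* Each column of [A] is isolated as the normal vector of one half-space. *)
have colA (x : 'rV[R]_d) j : (x *m A) ord0 j = (x *m col j A) ord0 ord0.
  by rewrite colE mulmxA -colE [RHS]mxE.
have -> : [set x | forall j : 'I_m, (x *m A) ord0 j <= b ord0 j] =
    \bigcap_j [set x : 'rV[R]_d | (x *m col j A) ord0 ord0 <= b ord0 j].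
  by apply/seteqP; split=> x /= xP j; [rewrite /= -colA|rewrite colA; exact: xP].
by apply: nonneg_neural_set_bigcap => j; exact: nonneg_neural_set_halfspace.
Qed.

(** Two nested finite unions: over the pieces, then over the convex polyhedra that make up each
    piece. *)
Lemma nonneg_neural_set_linear_pieces M :
  finite_union_of_linear_pieces M -> nonneg_neural_set M.
Proof.
move=> [n [Q [QP ->]]]; apply: nonneg_neural_set_bigcup => i.
have [[m [C [CP ->]]] _] := QP i.
apply: nonneg_neural_set_bigcup => j.
exact: nonneg_neural_set_convex_polyhedron.
Qed.

End ReluFunctions.

Theorem theorem1 (R : realType) (d : nat) (hd : (0 < d)%N) (M : set 'rV[R]_d)
  (hM : pl_hypersurface M) (hW : watertight M) :
  exists F : 'rV[R]_d -> R, is_relu_mlp F /\ M = neural_level_set F.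
Proof.
case: hM => _ /nonneg_neural_set_linear_pieces[F [FP _ ME]].
by exists F.
Qed.
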